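(* Let $K:\mathbb{N}_0\times\mathbb{N}_0\to\mathbb{C}$ be a strictly positive definite kernel with $K(0,0)=1$, and let $\{a_k,\ b_{k-1},\ c_{i,l}\mid k\ge 1,\ 0\le i<l\}$ be its Jacobi parameters. For $n\ge 1$, let $D_n=[d_{i,j}]_{0\le i,j\le n}$ be the upper triangular Cholesky factor (with positive diagonal) of $[K(i,j)]_{0\le i,j\le n}$. Then $$d_{i,j}=\sum_{\mathbf{p}\in\mathcal{L}_{j,i}}w(\mathbf{p}),\qquad 0\le i\le j\le n,\quad (i,j)\ne(0,0),$$ where $\mathcal{L}_{j,i}$ is the set of Lukasiewicz-type paths from $(0,0)$ to $(j,i)$ and $w$ is the weight determined by the Jacobi parameters, as defined in the context.
   Context: $\mathbb{N}_0=\{0,1,2,\dots\}$. A kernel $K:\mathbb{N}_0\times\mathbb{N}_0\to\mathbb{C}$ is strictly positive definite if $\sum_{k,j=1}^nK(p_k,p_j)\lambda_j\overline{\lambda}_k>0$ for all $n>0$, distinct $p_1,\dots,p_n\in\mathbb{N}_0$ and $\lambda_1,\dots,\lambda_n\in\mathbb{C}$ not all zero; equivalently, every matrix $K_n=[K(i,j)]_{0\le i,j\le n}$, $n\ge 0$, is (Hermitian) positive definite. Cholesky factor: $D_n=[d_{i,j}]_{0\le i,j\le n}$ is the unique upper triangular matrix with positive diagonal entries such that $K_n=D_n^*D_n$. By uniqueness $D_n$ is the leading principal $(n+1)\times(n+1)$ submatrix of $D_{n+1}$, so $d_{i,j}$ does not depend on $n$. Jacobi parameters: the Jacobi parameters of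 $K$ (with $K(0,0)=1$) are the uniquely determined numbers $a_k>0$ ($k\ge 1$), $b_k\in\mathbb{C}$ ($k\ge 0$), $c_{i,l}\in\mathbb{C}$ ($0\le i<l$) such that for every $n\ge 1$ the last column of $D_n$ is $$(d_{0,n},d_{1,n},\dots,d_{n,n})^{T}=J_{n+1,n}J_{n,n-1}\cdots J_{2,1},$$ where $J_{k+1,k}$ is the $(k+1)\times k$ matrix (rows indexed $0,\dots,k$, columns indexed $0,\dots,k-1$) whose $(i,l)$ entry is $c_{i,l}$ if $i<l$, $b_l$ if $i=l$, $a_{l+1}$ if $i=l+1$, and $0$ if $i>l+1$. In particular $J_{2,1}=\begin{bmatrix}b_0\\ a_1\end{bmatrix}$. Paths: for $n\ge 1$ and $k\ge 0$, $\mathcal{L}_{n,k}$ is the set of lattice paths in $\mathbb{Z}^2$ with $n$ steps, starting at $(0,0)$ and ending at $(n,k)$, never going below the horizontal axis, each step being a rise step $(j,l)\to(j+1,l+1)$, a horizontal step $(j,l)\to(j+1,l)$, or a fall step $(j,l)\to(j+1,r)$ with $0\le r<l$ (falls of arbitrary depth). Weight: if $\mathbf{p}\in\mathcal{L}_{n,k}$ consists of the steps $\mathbf{p}_1,\dots,\mathbf{p}_n$, then $w(\mathbf{p})=\prod_{s=1}^nw(\mathbf{p}_s)$, where $w(\mathbf{p}_s)=a_{l+1}$ if $\mathbf{p}_s$ is a rise step $(j,l)\to(j+1,l+1)$; $w(\mathbf{p}_s)=b_l$ if $\mathbf{p}_s$ is a horizontal step $(j,l)\to(j+1,l)$; and $w(\mathbf{p}_s)=c_{r,l}$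 if $\mathbf{p}_s$ is a fall step $(j,l)\to(j+1,r)$, $r<l$. *)

(* Defs.v *)
From mathcomp Require Import all_boot all_order all_algebra.
From mathcomp Require Export complex.
From mathcomp Require Import mathcomp_extra boolp classical_sets functions.
From mathcomp Require Import cardinality.
From mathcomp Require Export fsbigop reals.

Set Implicit Arguments.
Unset Strict Implicit.
Unset Printing Implicit Defensive.

Import Order.TTheory GRing.Theory Num.Theory.

Local Open Scope ring_scope.
Local Open Scope sesquilinear_scope.

(* [0 < z] in the complex field [R[i]] says that z is real and positive. *)
Definition strictly_positive_definite (R : realType) (K : nat -> nat -> R[i]) :=
  forall (n : nat) (p : 'I_n -> nat) (lam : 'I_n -> R[i]),
    (0 < n)%N -> injective p -> (exists k, lam k != 0) ->
    0 < \sum_(k < n) \sum_(j < n) K (p k) (p j) * lam j * (lam k)^*.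

Definition kernel_mx (R : realType) (K : nat -> nat -> R[i]) (n : nat) :
    'M[R[i]]_n.+1 :=
  \matrix_(i, j) K i j.

(* [is_trig_mx] means lower triangular, whence the transpose. *)
Definition is_cholesky (R : realType) (n : nat) (A D : 'M[R[i]]_n) :=
  [/\ is_trig_mx D^T, (forall i, 0 < D i i) & A = D^t* *m D].

(* The matrix J_{k+1,k}. *)
Definition jacobi_mx (R : realType) (a b : nat -> R[i])
    (c : nat -> nat -> R[i]) (k : nat) : 'M[R[i]]_(k.+1, k) :=
  \matrix_(i, l) if (i < l)%N then c i l
                 else if i == l :> nat then b l
                 else if i == l.+1 :> nat then a l.+1
                 else 0.

(* The column J_{n+1,n} ... J_{2,1}; it is [1] when n = 0. *)
Fixpoint jacobi_col (R : realType) (a b : nat -> R[i])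
    (c : nat -> nat -> R[i]) (n : nat) : 'cV[R[i]]_n.+1 :=
  if n is m.+1 then jacobi_mx a b c m.+1 *m jacobi_col a b c m else 1%:M.

(* Only the values a k with k >= 1 and c i l with i < l are relevant.  For a
   strictly positive definite K there is exactly one D as below for each n. *)
Definition jacobi_parameters (R : realType) (K : nat -> nat -> R[i])
    (a b : nat -> R[i]) (c : nat -> nat -> R[i]) :=
  (forall k, (1 <= k)%N -> 0 < a k) /\
  (forall n (D : 'M[R[i]]_n.+1), (1 <= n)%N ->
     is_cholesky (kernel_mx K n) D -> col ord_max D = jacobi_col a b c n).

(* Lattice points are pairs of naturals: a path from (0,0) has nonnegative
   abscissas, and nonnegative ordinates express that it stays above the
   horizontal axis. *)
Definition rise_step (x y : nat * nat) := y == (x.1.+1, x.2.+1).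
Definition horizontal_step (x y : nat * nat) := y == (x.1.+1, x.2).
Definition fall_step (x y : nat * nat) := (y.1 == x.1.+1) && (y.2 < x.2)%N.

Definition luk_step : rel (nat * nat) := fun x y =>
  [|| rise_step x y, horizontal_step x y | fall_step x y].

(* A path is the sequence of its vertices without the initial one (0,0). *)
Definition luk_paths (n k : nat) : set (seq (nat * nat)) :=
  [set p | [/\ path luk_step (0%N, 0%N) p, size p = n
             & last (0%N, 0%N) p = (n, k)]].

Definition step_weight (R : realType) (a b : nat -> R[i])
    (c : nat -> nat -> R[i]) (x y : nat * nat) : R[i] :=
  if rise_step x y then a x.2.+1
  else if horizontal_step x y then b x.2
  else c y.2 x.2.

Definition path_weight (R : realType) (a b : nat -> R[i])
    (c : nat -> nat -> R[i]) (p : seq (nat * nat)) : R[i] :=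
  \prod_(w <- pairmap (step_weight a b c) (0%N, 0%N) p) w.

Lemma luk_path_bounded (p : seq (nat * nat)) (x : nat * nat) (m : nat) :
  path luk_step x p -> (x.1 + size p <= m)%N -> (x.2 + size p <= m)%N ->
  all (fun y => (y.1 <= m)%N && (y.2 <= m)%N) p.
Proof.
elim: p x => //= y p IH x /andP[xy yp] h1 h2.
have [e1 e2] : y.1 = x.1.+1 /\ (y.2 <= x.2.+1)%N.
  by case/or3P: xy => [/eqP->|/eqP->|/andP[/eqP-> /ltnW/leqW]].
have e2' : (y.2 + size p <= m)%N.
  by apply: leq_trans h2; rewrite addnS -addSn leq_add2r.
have e1' : (y.1 + size p <= m)%N by rewrite e1 addSn -addnS.
rewrite (IH y yp e1' e2') andbT.
by rewrite (leq_trans (leq_addr _ _) e1') (leq_trans (leq_addr _ _) e2').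
Qed.

(* Hence [\sum_(p \in luk_paths n k)] is a genuine finite sum. *)
Lemma finite_luk_paths (n k : nat) : finite_set (luk_paths n k).
Proof.
pose f (t : n.-tuple ('I_n.+1 * 'I_n.+1)) : seq (nat * nat) :=
  [seq (nat_of_ord z.1, nat_of_ord z.2) | z <- t].
apply: (@sub_finite_set _ _ [set f t | t in [set: n.-tuple ('I_n.+1 * 'I_n.+1)]]%classic).
  move=> p /= [hp sp _].
  have hb := @luk_path_bounded p (0%N, 0%N) n hp.
  rewrite /= add0n sp leqnn in hb; have {}hb := hb isT isT.
  pose q : seq ('I_n.+1 * 'I_n.+1) := [seq (inord y.1, inord y.2) | y <- p].
  have sq : size q == n by rewrite size_map sp.
  exists (Tuple sq) => //; rewrite /f /= /q -map_comp -[RHS]map_id.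
  apply/eq_in_map => y yp /=; have /andP[y1 y2] := allP hb y yp.
  by rewrite !inordK //; case: (y).
by apply: finite_image; exact: finite_finset.
Qed.

(* Main.v *)
(* Leading principal blocks of an upper triangular Cholesky factor are Cholesky
   factors of the leading blocks of the kernel, so column j of D is the
   product J_{j+1,j} ... J_{2,1}.  Entry (i, l) of J_{j+1,j} is the weight of
   the step from height l to height i (zero when there is no such step), so
   multiplying by it is summing over the last step of a path. *)
Require Import Defs.
From mathcomp Require Import all_boot all_order all_algebra.
From mathcomp Require Import classical_sets.
Import Order.TTheory GRing.Theory Num.Theory.
Local Open Scope ring_scope.

Lemma luk_stepE (x y : nat * nat) :
  luk_step x y = (y.1 == x.1.+1) && (y.2 <= x.2.+1)%N.
Proof.
case: x y => [m l] [m' k].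
rewrite /luk_step /rise_step /horizontal_step /fall_step !xpair_eqE /=.
by rewrite -!andb_orr [in RHS]leq_eqVlt ltnS [in RHS]leq_eqVlt.
Qed.

Lemma last_luk_path (x : nat * nat) (p : seq (nat * nat)) :
  path luk_step x p ->
  (last x p).1 = (x.1 + size p)%N /\ ((last x p).2 <= x.2 + size p)%N.
Proof.
elim: p x => [x _|y p IH x] /=; first by rewrite !addn0.
rewrite luk_stepE => /andP[/andP[/eqP y1 y2] /IH[-> le2]].
rewrite y1 -!addSnnS; split=> //.
by rewrite (leq_trans le2) // leq_add2r.
Qed.

(** Enumerates [luk_paths n k] by the height [l] of the penultimate vertex, so that the recursion
    mirrors one multiplication by a Jacobi matrix. The bound [l <= m] loses nothing, since [m] steps
    rise by at most [m]; it is also the column range of [jacobi_mx a b c m.+1]. *)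
Fixpoint luk_seq (n k : nat) : seq (seq (nat * nat)) :=
  if n is m.+1 then
    [seq rcons p (m.+1, k) | l <- [seq l <- iota 0 m.+1 | (k <= l.+1)%N],
                             p <- luk_seq m l]
  else if k == 0%N then [:: [::]] else [::].

Lemma luk_seqS (m k : nat) :
  luk_seq m.+1 k =
  [seq rcons p (m.+1, k) | l <- [seq l <- iota 0 m.+1 | (k <= l.+1)%N],
                           p <- luk_seq m l].
Proof. by []. Qed.

Lemma mem_luk_seq (n k : nat) (p : seq (nat * nat)) :
  reflect (luk_paths n k p) (p \in luk_seq n k).
Proof.
elim: n k p => [|m IH] k p; last rewrite luk_seqS.
  apply: (iffP idP) => [|[_ /size0nil-> [<-]]]; last by [].
  by rewrite /=; case: eqP => // ->; rewrite inE => /eqP->.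
apply: (iffP allpairsPdep) => [[l [q [+ /IH[hq sq lq] ->]]]|].
  rewrite mem_filter => /andP[kl _].
  split; rewrite ?size_rcons ?sq ?last_rcons //.
  by rewrite rcons_path hq lq luk_stepE /= eqxx.
case: p / lastP => [[]//|q y [+ + +]].
rewrite size_rcons rcons_path last_rcons luk_stepE.
move=> /andP[hq /andP[_ y2]] [sq] yE; subst y.
(* The prefix [q] ends at abscissa [m] and at height at most [m], so its final height lies in the
   enumerated range. *)
have [l1 l2] := last_luk_path _ _ hq; rewrite sq !add0n in l1 l2.
exists (last (0%N, 0%N) q).2, q; split; last by [].
  by rewrite mem_filter y2 mem_iota add0n ltnS.
by apply/IH; split; rewrite // -l1 -surjective_pairing.
Qed.

(** A prefix determines its own final height, so the blocks for different [l] are disjoint. *)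
Lemma luk_seq_uniq (n k : nat) : uniq (luk_seq n k).
Proof.
elim: n k => [|m IH] k; first by rewrite /=; case: eqP.
rewrite luk_seqS.
apply: allpairs_uniq_dep => [|l _|]; rewrite ?filter_uniq ?iota_uniq //.
move=> _ _ /allpairsPdep[l [p [_ pl ->]]] /allpairsPdep[l' [p' [_ pl' ->]]] /=.
move=> /rcons_inj[pp']; subst p'.
move: pl pl' => /mem_luk_seq[_ _ e] /mem_luk_seq[_ _]; rewrite e => -[->].
by [].
Qed.

Section LukasiewiczSum.
Variables (R : realType) (a b : nat -> R[i]) (c : nat -> nat -> R[i]).

Lemma sum_luk_paths (n k : nat) :
  \sum_(p \in luk_paths n k) path_weight a b c p =
  \sum_(p <- luk_seq n k) path_weight a b c p.
Proof.
rewrite (fsbig_seq _ _ (luk_seq_uniq n k)).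
by apply: eq_fsbigl; apply/seteqP; split=> p /= /mem_luk_seq.
Qed.

Lemma path_weight_rcons (p : seq (nat * nat)) (y : nat * nat) :
  path_weight a b c (rcons p y) =
  path_weight a b c p * step_weight a b c (last (0%N, 0%N) p) y.
Proof.
by rewrite /path_weight -cats1 pairmap_cat big_cat /= big_seq1.
Qed.

(** The abscissa [k] is arbitrary because weights depend only on heights. The test [i <= l.+1] is
    needed: [step_weight] falls through to [c] on jumps higher than a rise, where the matrix entry
    is 0. *)
Lemma jacobi_mxE (m k : nat) (i : 'I_m.+1) (l : 'I_m) :
  jacobi_mx a b c m i l =
  if (i <= l.+1)%N then step_weight a b c (k, l : nat) (k.+1, i : nat) else 0.
Proof.
rewrite mxE /step_weight /rise_step /horizontal_step !xpair_eqE eqxx /=.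
have [->|/negbTE il] := eqVneq (i : nat) l.+1.
  by rewrite leqnn ltnNge leqnSn gtn_eqF.
by rewrite [(i <= _)%N]leq_eqVlt il ltnS; case: ltngtP.
Qed.

Lemma jacobi_colE (n : nat) (i : 'I_n.+1) (j : 'I_1) :
  jacobi_col a b c n i j = \sum_(p \in luk_paths n i) path_weight a b c p.
Proof.
rewrite sum_luk_paths; elim: n i j => [|m IH] i j.
  by rewrite !ord1 mxE /= big_seq1 /path_weight /= big_nil.
rewrite luk_seqS big_allpairs_dep big_filter.
rewrite -[iota 0 _]/(index_iota 0 m.+1) big_mkord.
rewrite -[jacobi_col a b c _]/(jacobi_mx a b c m.+1 *m jacobi_col a b c m).
(* Heights [l] rejected by the filter become zero terms, matching the zeros of the Jacobi matrix
   below its subdiagonal. *)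
rewrite mxE [RHS]big_mkcond; apply: eq_bigr => l _.
(* The abscissa is chosen as [m], where the prefixes in [luk_seq m l] end. *)
rewrite (jacobi_mxE _ m); case: ifP => _; last by rewrite mul0r.
rewrite IH mulr_sumr big_seq [RHS]big_seq.
apply: eq_bigr => p /mem_luk_seq[_ _ e].
by rewrite path_weight_rcons e mulrC.
Qed.

End LukasiewiczSum.

(** For [i, j <= m], the terms of entry [(i, j)] of [D^t* *m D] with index [k > m] contain [D k j],
    which vanishes because [k > j]. *)
Lemma is_cholesky_leading (R : realType) (K : nat -> nat -> R[i]) (m n : nat)
    (le_mn : (m < n.+1)%N) (D : 'M[R[i]]_n.+1) :
  is_cholesky (kernel_mx K n) D ->
  is_cholesky (kernel_mx K m)
    (mxsub (widen_ord le_mn) (widen_ord le_mn) D).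
Proof.
move=> [/is_trig_mxP Dtrig Dpos KD]; split.
- apply/is_trig_mxP => i j lt_ij.
  by have := Dtrig (widen_ord le_mn i) (widen_ord le_mn j) lt_ij; rewrite !mxE.
- by move=> i; rewrite mxE.
apply/matrixP => i j.
have := congr1 (fun A : 'M_n.+1 => A (widen_ord le_mn i) (widen_ord le_mn j)) KD.
rewrite !mxE /= => ->.
rewrite (bigID (fun k : 'I_n.+1 => (k < m.+1)%N)) /= [X in _ + X]big1 ?addr0.
  rewrite (big_ord_narrow le_mn).
  by apply: eq_bigr => k _; rewrite !mxE.
move=> k; rewrite -leqNgt => lt_mk.
have := Dtrig (widen_ord le_mn j) k (leq_trans (ltn_ord j) lt_mk).
by rewrite mxE => ->; rewrite mulr0.
Qed.

Theorem theorem3p5 (R : realType) (K : nat -> nat -> R[i])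
    (hK : strictly_positive_definite K) (hK00 : K 0%N 0%N = 1)
    (a b : nat -> R[i]) (c : nat -> nat -> R[i])
    (hJ : jacobi_parameters K a b c)
    (n : nat) (hn : (1 <= n)%N)
    (D : 'M[R[i]]_n.+1) (hD : is_cholesky (kernel_mx K n) D)
    (i j : 'I_n.+1) (hij : (i <= j)%N) (hij0 : (i : nat, j : nat) <> (0%N, 0%N)) :
  D i j = \sum_(p \in luk_paths j i) path_weight a b c p.
Proof.
(* [jacobi_parameters] describes only columns of index at least 1; this is where [(i, j) <> (0, 0)]
   enters. *)
have j_gt0 : (1 <= j)%N.
  rewrite lt0n; apply/eqP => j0; apply: hij0.
  by move: hij; rewrite j0 leqn0 => /eqP->.
(* Truncating [D] to size [j.+1] makes column [j] the last one. *)
have := proj2 hJ j _ j_gt0 (is_cholesky_leading _ _ _ _ (ltn_ord j) _ hD).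
move=> /matrixP/(_ (Ordinal (hij : (i < j.+1)%N)) 0).
rewrite jacobi_colE /= => <-; rewrite !mxE.
by congr (D _ _); apply: val_inj.
Qed.
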